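(* Let $Y$ be a real vector space, $A\subseteq Y$ nonempty and $k\in Y\setminus\{0\}$. Then $$\operatorname{dom}\varphi_{A,k}=A+\mathbb{R}k,$$ $$\varphi_{A,k}(y+tk)=\varphi_{A,k}(y)+t\quad\text{for all } y\in Y,\ t\in\mathbb{R},$$ $$\varphi_{A,k}(y)\le t\quad\text{for all } t\in\mathbb{R},\ y\in A+tk,$$ $$\varphi_{A,k}(y)<t\quad\text{for all } t\in\mathbb{R},\ y\in \operatorname{core}A+tk.$$ Moreover: (a) One has $\{y\in Y\mid\varphi_{A,k}(y)<t\}\subseteq A+tk$ for all $t\in\mathbb{R}$ if and only if $k\in-0^+A$. (b) If $A$ is $k$-directionally closed, then $\{y\in Y\mid\varphi_{A,k}(y)=t\}\subseteq A+tk$ for all $t\in\mathbb{R}$. (c) One has $\{y\in Y\mid\varphi_{A,k}(y)\le t\}=A+tk$ for all $t\in\mathbb{R}$ if and only if $k\in-0^+A$ and $A$ is $k$-directionally closed. (d) The following two conditions are equivalent to each other: (i) $A-\mathbb{R}_{>}\cdot k\subseteq\operatorname{core}A$; (ii) $\{y\in Y\mid\varphi_{A,k}(y)<t\}=\operatorname{core}A+tk$ for all $t\in\mathbb{R}$. Condition (i) implies $\operatorname{dom}\varphi_{A,k}=\operatorname{core}\operatorname{dom}\varphi_{A,k}$. (e) If $A\subseteq A_0\subseteq Y$, then $\operatorname{dom}\varphi_{A,k}\subseteq\operatorname{dom}\varphi_{A_0,k}$, and $\varphi_{A_0,k}(y)\le\varphi_{A,k}(y)$ for all $y\in\operatorname{dom}\varphi_{A,k}$.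 (f) If $k\in 0^+A$, then $\varphi_{A,k}(y)=-\infty$ for all $y\in\operatorname{dom}\varphi_{A,k}$.
   Context: Let $\nu$ be a symbol not in $\overline{\mathbb{R}}=\mathbb{R}\cup\{-\infty,+\infty\}$ and $\overline{\mathbb{R}}_\nu:=\overline{\mathbb{R}}\cup\{\nu\}$. Conventions: $\inf\emptyset=\nu$; $\nu$ is not comparable with real numbers (so $\varphi(y)\le t$, $\varphi(y)<t$, $\varphi(y)=t$ are all false for $t\in\mathbb{R}$ if $\varphi(y)=\nu$); $\nu+t=\nu$ and $-\infty+t=-\infty$ for $t\in\mathbb{R}$. For nonempty $A\subseteq Y$ and $k\in Y\setminus\{0\}$, $\varphi_{A,k}:Y\to\overline{\mathbb{R}}_\nu$ is defined by $\varphi_{A,k}(y):=\inf\{t\in\mathbb{R}\mid y\in A+tk\}$ (value $-\infty$ if the set is unbounded below). Its domain is $\operatorname{dom}\varphi_{A,k}=\{y\in Y\mid\varphi_{A,k}(y)\in\mathbb{R}\cup\{-\infty\}\}$. $\mathbb{R}_+=[0,\infty)$, $\mathbb{R}_>=(0,\infty)$. The recession cone of $A$ is $0^+A:=\{u\in Y\mid\forall a\in A\ \forall t\in\mathbb{R}_+:\ a+tu\in A\}$. $\operatorname{core}A$ is the algebraic interior of $A$: $a\in\operatorname{core}A$ iff $a\in A$ and for each $v\in Y$ there is $\varepsilon>0$ with $a+sv\in A$ for all $s\in[0,\varepsilon]$. $A$ is $k$-directionally closed if for every $y\in Y$: whenever there is a sequence $(t_n)$ of positive reals decreasing to $0$ with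 $y-t_nk\in A$ for all $n$, then $y\in A$. *)

(* Defs.v *)
From mathcomp Require Import all_boot all_order all_algebra.
From mathcomp Require Import all_classical all_reals all_analysis.

Set Implicit Arguments.
Unset Strict Implicit.
Unset Printing Implicit Defensive.

Import Order.TTheory GRing.Theory Num.Theory.
Import numFieldNormedType.Exports.

Local Open Scope classical_set_scope.
Local Open Scope ring_scope.

(* The extended reals together with one further symbol nu, which is [None]. *)
Definition ereal_nu (R : realType) := option (\bar R).

(* nu is comparable with nothing: both relations are false as soon as one of
   their arguments is nu. *)
Definition le_nu (R : realType) (x y : ereal_nu R) : Prop :=
  match x, y with
  | Some a, Some b => (a <= b)%E
  | _, _ => False
  end.

Definition lt_nu (R : realType) (x y : ereal_nu R) : Prop :=
  match x, y with
  | Some a, Some b => (a < b)%E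
  | _, _ => False
  end.

Definition real_nu (R : realType) (t : R) : ereal_nu R := Some t%:E.

Definition add_nu (R : realType) (x : ereal_nu R) (t : R) : ereal_nu R :=
  omap (fun a => a + t%:E)%E x.

(* The infimum of a set of reals, with the convention inf set0 = nu (instead
   of [ereal_inf set0 = +oo]); it is -oo when the set is unbounded below. *)
Definition inf_nu (R : realType) (S : set R) : ereal_nu R :=
  if S == set0 then None else Some (ereal_inf (EFin @` S)).

Section RealVectorSpace.
Variables (R : realType) (Y : lmodType R).
Implicit Types (A : set Y) (k : Y) (t : R).

Definition translate A k t : set Y := [set a + t *: k | a in A].

Definition add_span A k (T : set R) : set Y :=
  [set a + t *: k | a in A & t in T].

Definition phi A k (y : Y) : ereal_nu R := inf_nu [set t | translate A k t y].

Definition dom_phi A k : set Y :=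
  [set y | (exists r : R, phi A k y = Some r%:E) \/ phi A k y = Some -oo%E].

Definition recession_cone A : set Y :=
  [set u | forall a t, A a -> 0 <= t -> A (a + t *: u)].

Definition alg_core A : set Y :=
  [set a | A a /\ forall v : Y, exists2 e : R, 0 < e &
             forall s : R, 0 <= s <= e -> A (a + s *: v)].

Definition directionally_closed A k : Prop :=
  forall (y : Y) (u : nat -> R),
    (forall n, 0 < u n) -> nonincreasing_seq u -> u @ \oo --> (0 : R) ->
    (forall n, A (y - u n *: k)) -> A y.

End RealVectorSpace.

(* Main.v *)
Require Import Defs.
From mathcomp Require Import all_boot all_order all_algebra.
From mathcomp Require Import all_classical all_reals all_analysis.

(** Everything is read off the set of parameters [t] with [y - t *: k] in [A],
    that is, the trace of [A] on the line through [y] in direction [k].  The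
    functional [phi] is the infimum of this set, so that [phi A k y < t] holds
    exactly when some [s < t] belongs to it ([lt_phiP]).  Since [phi] never takes the value [+oo],
    its value is determined by the reals strictly above it ([lt_nu_inj]); hence
    the domain, the translation rule, monotonicity in [A] and the degenerate
    case of a recession direction follow by comparing strict sublevel sets.

    Recession and core conditions say how the parameter set behaves when [t]
    moves.  If [- k] is a recession direction, the set is closed upwards, so a
    parameter [s < t] yields the parameter [t]: this is (a).  If [A - t *: k]
    lies in the core for every [t > 0], the same move lands in the core, which
    is (d); conversely a core point can be pushed a little along [k], which
    makes the inequality strict.

    The only limit argument is (b): when the infimum [t] is finite and not
    attained, parameters accumulate at [t] from above, and a nonincreasing
    sequence can be extracted from them ([nonincreasing_extraction]);
    directional closedness applied along it says that [t] is attained after all.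
    Then (c) combines (a) for [<] and (b) for [=]. *)

Set Implicit Arguments.
Unset Strict Implicit.
Unset Printing Implicit Defensive.

Import Order.TTheory GRing.Theory Num.Theory.
Import numFieldNormedType.Exports.

Local Open Scope classical_set_scope.
Local Open Scope ring_scope.

(** * Translates, recession directions and the order with nu *)

Lemma translateP (R : realType) (Y : lmodType R) (A : set Y) (k y : Y) (t : R) :
  translate A k t y <-> A (y - t *: k).
Proof.
split=> [[a Aa <-]|Ay]; first by rewrite addrK.
by exists (y - t *: k) => //; rewrite subrK.
Qed.

Lemma recession_coneNP (R : realType) (Y : lmodType R) (A : set Y) (k : Y) :
  [set - u | u in recession_cone A] k <->
  (forall a t, A a -> 0 <= t -> A (a - t *: k)).
Proof.
split=> [[u Au <-] a t Aa t0|H]; first by rewrite scalerN opprK; exact: Au.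
by exists (- k); rewrite ?opprK // => a t Aa t0; rewrite scalerN; exact: H.
Qed.

Lemma lt_nu_add (R : realType) (x : ereal_nu R) (t r : R) :
  lt_nu (add_nu x t) (real_nu r) <-> lt_nu x (real_nu (r - t)).
Proof. by case: x => [x|] //=; rewrite EFinB lteBrDr. Qed.

Lemma le_nu_real (R : realType) (x : ereal_nu R) (t : R) :
  le_nu x (real_nu t) <-> lt_nu x (real_nu t) \/ x = real_nu t.
Proof.
case: x => [x|] /=; last by split=> // -[].
rewrite le_eqVlt; split=> [/orP[/eqP->|->]|[->|[->]]]; rewrite ?eqxx ?orbT //.
  by right.
by left.
Qed.

Lemma le_nu_realP (R : realType) (x : ereal_nu R) (t : R) :
  le_nu x (real_nu t) <-> (forall r, t < r -> lt_nu x (real_nu r)).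
Proof.
split=> [|H].
  by case: x => [x|] //= xt r tr; apply: le_lt_trans xt _; rewrite lte_fin.
case: x H => [x|] /= H; last by apply: (H (t + 1)); rewrite ltrDl.
apply/lee_addgt0Pr => e e0; apply: ltW; rewrite -EFinD.
by apply: H; rewrite ltrDl.
Qed.

(** A value other than [+oo] is determined by the reals above it; [+oo] has to
    be excluded because, like [nu], it has no real above it. *)
Lemma lt_nu_inj (R : realType) (x y : ereal_nu R) :
  x <> Some +oo%E -> y <> Some +oo%E ->
  (forall r, lt_nu x (real_nu r) <-> lt_nu y (real_nu r)) -> x = y.
Proof.
have real_above (a : \bar R) : Some a <> Some +oo%E ->
    exists r : R, (a < r%:E)%E.
  case: a => [a| |] // _; last by exists 0; rewrite ltNye.
  by exists (a + 1); rewrite lte_fin ltrDl.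
have le_of_lt (a b : \bar R) : Some b <> Some +oo%E ->
    (forall r : R, (b < r%:E)%E -> (a < r%:E)%E) -> (a <= b)%E.
  case: b => [b| |] // _ H.
    apply/lee_addgt0Pr => e e0; apply: ltW; rewrite -EFinD.
    by apply: H; rewrite lte_fin ltrDl.
  have {}H r : (a < r%:E)%E by apply: H; rewrite ltNye.
  by case: a H => [a /(_ a)|/(_ 0)|] //; rewrite ltxx.
case: x => [a|]; case: y => [b|] //= ax bx H.
- congr Some; apply/eqP; rewrite eq_le !le_of_lt // => r /H //.
- by have [r /H] := real_above _ ax.
- by have [r /H] := real_above _ bx.
Qed.

(** * The functional, its strict sublevel sets and its domain *)

Lemma phi_neq_pinfty (R : realType) (Y : lmodType R) (A : set Y) (k y : Y) :
  phi A k y <> Some +oo%E.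
Proof.
rewrite /phi /inf_nu; case: eqP => // /eqP/set0P[t At] [E].
have : (ereal_inf (EFin @` [set t | translate A k t y]) <= t%:E)%E.
  by apply: ereal_inf_lbound; exists t.
by rewrite E leye_eq.
Qed.

(** An infimum is below [t] exactly when a member of the set is.  The empty
    parameter set is covered too, since [nu] is below nothing. *)
Lemma lt_phiP (R : realType) (Y : lmodType R) (A : set Y) (k y : Y) (t : R) :
  lt_nu (phi A k y) (real_nu t) <-> (exists2 s, s < t & A (y - s *: k)).
Proof.
rewrite /phi /inf_nu; case: eqP => [S0|_] /=.
  split=> // -[s _ /translateP As].
  by have : [set t | translate A k t y] s by []; rewrite S0.
split=> [/ereal_inf_lt[_ [s /translateP As <-]] st|[s st As]].
  by exists s; rewrite -?lte_fin.
apply: (@le_lt_trans _ _ s%:E); last by rewrite lte_fin.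
by apply: ereal_inf_lbound; exists s => //; apply/translateP.
Qed.

Lemma le_phi (R : realType) (Y : lmodType R) (A : set Y) (k y : Y) (t : R) :
  A (y - t *: k) -> le_nu (phi A k y) (real_nu t).
Proof. by move=> At; apply/le_nu_realP => r tr; apply/lt_phiP; exists t. Qed.

Lemma dom_phiP (R : realType) (Y : lmodType R) (A : set Y) (k y : Y) :
  dom_phi A k y <-> exists t, A (y - t *: k).
Proof.
split=> [[[r E]|E]|[t /le_phi]].
- have /lt_phiP[s _ As] : lt_nu (phi A k y) (real_nu (r + 1)).
    by rewrite E /= lte_fin ltrDl.
  by exists s.
- have /lt_phiP[s _ As] : lt_nu (phi A k y) (real_nu 0) by rewrite E /= ltNye.
  by exists s.
- rewrite /dom_phi /=; case: (phi A k y) => [[r| |]|] //= _; last by right.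
  by left; exists r.
Qed.

Lemma dom_phi_span (R : realType) (Y : lmodType R) (A : set Y) (k : Y) :
  dom_phi A k = add_span A k setT.
Proof.
apply/seteqP; split=> y.
  move=> /dom_phiP[t At]; exists (y - t *: k) => //.
  by exists t => //; rewrite subrK.
by move=> [a Aa [t _ <-]]; apply/dom_phiP; exists t; rewrite addrK.
Qed.

(** Translating [y] by [t *: k] shifts the parameter set by [t]. *)
Lemma phi_translate (R : realType) (Y : lmodType R) (A : set Y) (k y : Y)
    (t : R) :
  phi A k (y + t *: k) = add_nu (phi A k y) t.
Proof.
apply: lt_nu_inj => [||r]; first exact: phi_neq_pinfty.
  by have := @phi_neq_pinfty _ _ A k y; case: (phi A k y) => [[]|].
split=> [/lt_phiP[s sr As]|/lt_nu_add/lt_phiP[s sr As]].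
  apply/lt_nu_add/lt_phiP; exists (s - t); first by rewrite ltrD2r.
  by rewrite scalerBl opprB addrA.
apply/lt_phiP; exists (s + t); first by rewrite -ltrBrDr.
by rewrite scalerDl opprD addrACA subrr addr0.
Qed.

(** A core point remains in [A] when pushed slightly along [k], which lowers
    the parameter strictly below [t]. *)
Lemma lt_phi_core (R : realType) (Y : lmodType R) (A : set Y) (k y : Y)
    (t : R) :
  alg_core A (y - t *: k) -> lt_nu (phi A k y) (real_nu t).
Proof.
move=> [_ /(_ k)[e e0 He]]; apply/lt_phiP; exists (t - e).
  by rewrite ltrBlDr ltrDl.
by rewrite scalerBl opprB addrCA addrC; apply: He; rewrite lexx ltW.
Qed.

(** * Sublevel sets and recession directions *)

(** From left to right, a point [a] of [A] has [phi A k a <= 0 < t] for every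
    [t > 0], so the inclusion at level [t] says that [a - t *: k] is in [A]. *)
Lemma sublevel_phi_recession (R : realType) (Y : lmodType R) (A : set Y)
    (k : Y) :
  (forall t : R,
     [set y | lt_nu (phi A k y) (real_nu t)] `<=` translate A k t) <->
  [set - u | u in recession_cone A] k.
Proof.
split=> [H|/recession_coneNP Ak t y /lt_phiP[s st As]].
  apply/recession_coneNP => a t Aa; rewrite le_eqVlt => /predU1P[<-|t0].
    by rewrite scale0r subr0.
  apply/translateP/H/lt_phiP.
  by exists 0 => //; rewrite scale0r subr0.
apply/translateP.
have -> : y - t *: k = y - s *: k - (t - s) *: k.
  by rewrite scalerBl opprB addrA addrNK.
by apply: Ak => //; rewrite subr_ge0 ltW.
Qed.

(** * Attainment of the infimum and weak sublevel sets *)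

(** Each term is chosen below both its predecessor and [n.+1^-1]: the first
    bound gives monotonicity, the second convergence. *)
Lemma nonincreasing_extraction (R : realType) (S : set R) :
  (forall e, 0 < e -> exists2 s, 0 < s < e & S s) ->
  exists u : nat -> R, [/\ forall n, 0 < u n, nonincreasing_seq u,
    u @ \oo --> (0 : R) & forall n, S (u n)].
Proof.
move=> H.
have /choice[f Hf] e : exists s : R, (0 : R) < e -> 0 < s < e /\ S s.
  have [e0|e0] := ltP 0 e; last by exists 0.
  by have [s s0 Ss] := H e e0; exists s.
pose u n := iteri n (fun m v => f (Num.min v m.+2%:R^-1)) (f 1).
have inv_gt0 n : (0 : R) < n.+1%:R^-1 by rewrite invr_gt0 ltr0n.
have u_gt0 n : 0 < u n.
  elim: n => [|n IH] /=; first by have [] := Hf 1 ltr01 => /andP[].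
  by have [|/andP[]] := Hf (Num.min (u n) n.+2%:R^-1); rewrite ?lt_min ?IH /=.
have uS n : 0 < u n.+1 < Num.min (u n) n.+2%:R^-1 /\ S (u n.+1).
  by apply: Hf; rewrite lt_min u_gt0 /=.
have u0 : 0 < u 0%N < 1 /\ S (u 0%N) by exact: Hf.
exists u; split=> //.
- apply/nonincreasing_seqP => n.
  by have [/andP[_]] := uS n; rewrite lt_min => /andP[/ltW].
- apply: (@squeeze_cvgr _ _ _ _ (fun=> 0) (@harmonic R)).
  + apply: nearW => -[|n]; rewrite ltW ?u_gt0 //= /harmonic.
      by rewrite invr1; have [/andP[_ /ltW]] := u0.
    by have [/andP[_]] := uS n; rewrite lt_min => /andP[_ /ltW].
  + exact: cvg_cst.
  + exact: cvg_harmonic.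
- by case=> [|n]; [have [] := u0|have [] := uS n].
Qed.

(** If [t] is not a parameter of [y], the parameters accumulate at [t] strictly
    from above, and directional closedness applies at [y - t *: k]. *)
Lemma phi_attained (R : realType) (Y : lmodType R) (A : set Y) (k : Y) :
  directionally_closed A k ->
  forall t : R, [set y | phi A k y = real_nu t] `<=` translate A k t.
Proof.
move=> dA t y /= yt; apply/translateP; apply: contrapT => nAt.
have accum e : 0 < e -> exists2 s, 0 < s < e & A (y - (t + s) *: k).
  move=> e0; have : lt_nu (phi A k y) (real_nu (t + e)).
    by rewrite yt /= lte_fin ltrDl.
  move=> /lt_phiP[s ste As]; exists (s - t); last by rewrite [t + _]addrC subrK.
  rewrite ltrBlDl ste andbT subr_gt0 lt_neqAle; apply/andP; split.
    by apply/eqP => ts; apply: nAt; rewrite ts.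
  by have := le_phi As; rewrite yt /= lee_fin.
have [u [u0 um uc uA]] :=
  @nonincreasing_extraction R [set s | A (y - (t + s) *: k)] accum.
apply: nAt; apply: (dA _ u) => // n.
by rewrite -addrA -opprD -scalerDl; exact: uA.
Qed.

(** Directional closedness is forced because [A (y - u n *: k)] for all [n] gives
    [phi A k y <= 0], and the sublevel set at level 0 is [A] itself. *)
Lemma weak_sublevel_phi (R : realType) (Y : lmodType R) (A : set Y) (k : Y) :
  (forall t : R,
     [set y | le_nu (phi A k y) (real_nu t)] = translate A k t) <->
  [set - u | u in recession_cone A] k /\ directionally_closed A k.
Proof.
split=> [H|[Ak dA] t].
  split.
    apply/sublevel_phi_recession => t y ylt; rewrite -H.
    by apply/le_nu_real; left.
  move=> y u u0 um uc uA.
  suff : translate A k 0 y by move=> /translateP; rewrite scale0r subr0.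
  rewrite -H; apply/le_nu_realP => r r0; apply/lt_phiP.
  have /(_ r r0) [N _ uN] : forall e : R, 0 < e -> \forall n \near \oo, u n < e.
    by move=> e e0; exact: (cvgr_lt _ uc).
  by exists (u N) => //; exact: (uN N (leqnn N)).
apply/seteqP; split=> y; last by move=> /translateP /le_phi.
move=> /le_nu_real[]; first exact: (sublevel_phi_recession A k).2.
exact: phi_attained.
Qed.

(** * Sublevel sets and the algebraic core *)

(** The inclusion of translates of the core always holds; the other one and the
    core condition are translations of each other, as for recession directions. *)
Lemma strict_sublevel_phi_core (R : realType) (Y : lmodType R) (A : set Y)
    (k : Y) :
  [set a - t *: k | a in A & t in [set t : R | 0 < t]] `<=` alg_core A <->
  forall t : R,
    [set y | lt_nu (phi A k y) (real_nu t)] = translate (alg_core A) k t.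
Proof.
split=> [Ac t|H _ [a Aa [t t0 <-]]].
  apply/seteqP; split=> y; last by move=> /translateP /lt_phi_core.
  move=> /lt_phiP[s st As]; apply/translateP/Ac.
  exists (y - s *: k) => //; exists (t - s); first by rewrite /= subr_gt0.
  by rewrite scalerBl opprB addrA addrNK.
apply/translateP; rewrite -H; apply/lt_phiP.
by exists 0 => //; rewrite scale0r subr0.
Qed.

(** Moving back along [k] by one unit puts a point of [A] into the core, and
    the domain is invariant under translation along [k]. *)
Lemma dom_phi_alg_open (R : realType) (Y : lmodType R) (A : set Y) (k : Y) :
  [set a - t *: k | a in A & t in [set t : R | 0 < t]] `<=` alg_core A ->
  dom_phi A k = alg_core (dom_phi A k).
Proof.
move=> Ac; apply/seteqP; split=> [y yA|y []//]; split=> // v.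
have /dom_phiP[t At] := yA.
have [|_ /(_ v)[e e0 He]] := Ac (y - (t + 1) *: k).
  exists (y - t *: k) => //; exists 1; first exact: ltr01.
  by rewrite scalerDl opprD addrA.
exists e => // s se; apply/dom_phiP; exists (t + 1).
by rewrite addrAC; exact: He.
Qed.

(** * Monotonicity in the set and recession directions with value -oo *)

Lemma phi_antimono (R : realType) (Y : lmodType R) (A A0 : set Y) (k : Y) :
  A `<=` A0 ->
  dom_phi A k `<=` dom_phi A0 k /\
  (forall y : Y, dom_phi A k y -> le_nu (phi A0 k y) (phi A k y)).
Proof.
move=> AA0; split=> [y /dom_phiP[t At]|y domy].
  by apply/dom_phiP; exists t; exact: AA0.
have lt0 r : lt_nu (phi A k y) (real_nu r) -> lt_nu (phi A0 k y) (real_nu r).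
  by move=> /lt_phiP[s sr As]; apply/lt_phiP; exists s => //; exact: AA0.
case: domy lt0 => [[r ->]|->] lt0.
  by apply/le_nu_realP => s rs; apply: lt0; rewrite /= lte_fin.
rewrite (_ : phi A0 k y = Some -oo%E) //=.
apply: lt_nu_inj => // [|r]; first exact: phi_neq_pinfty.
by split=> [_|/lt0]; rewrite //= ltNye.
Qed.

Lemma phi_recession (R : realType) (Y : lmodType R) (A : set Y) (k : Y) :
  recession_cone A k ->
  forall y : Y, dom_phi A k y -> phi A k y = Some -oo%E.
Proof.
move=> Ak y /dom_phiP[t At]; apply: lt_nu_inj => // [|r].
  exact: phi_neq_pinfty.
split=> [_|_]; first by rewrite /= ltNye.
(* The parameter set is closed downwards, so a point of it below [r] is found
   under [Num.min t r]; subtracting 1 makes the inequality strict. *)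
apply/lt_phiP; exists (Num.min t r - 1).
  by rewrite ltrBlDr gt_min ltrDl ltr01 orbT.
have -> : y - (Num.min t r - 1) *: k
    = y - t *: k + (t - (Num.min t r - 1)) *: k.
  by rewrite [(t - _) *: k]scalerBl addrA addrNK.
apply: Ak => //; rewrite subr_ge0 lerBlDr.
by rewrite ge_min lerDl ler01.
Qed.

Theorem theorem1 (R : realType) (Y : lmodType R) (A : set Y) (k : Y)
    (A_neq0 : A !=set0) (k_neq0 : k != 0) :
  dom_phi A k = add_span A k setT /\
  (forall (y : Y) (t : R), phi A k (y + t *: k) = add_nu (phi A k y) t) /\
  (forall (t : R) (y : Y), translate A k t y ->
     le_nu (phi A k y) (real_nu t)) /\
  (forall (t : R) (y : Y), translate (alg_core A) k t y ->
     lt_nu (phi A k y) (real_nu t)) /\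
  (* (a) *)
  ((forall t : R,
      [set y | lt_nu (phi A k y) (real_nu t)] `<=` translate A k t) <->
   [set - u | u in recession_cone A] k) /\
  (* (b) *)
  (directionally_closed A k ->
   forall t : R, [set y | phi A k y = real_nu t] `<=` translate A k t) /\
  (* (c) *)
  ((forall t : R,
      [set y | le_nu (phi A k y) (real_nu t)] = translate A k t) <->
   [set - u | u in recession_cone A] k /\ directionally_closed A k) /\
  (* (d) *)
  (([set a - t *: k | a in A & t in [set t : R | 0 < t]] `<=` alg_core A <->
    forall t : R,
      [set y | lt_nu (phi A k y) (real_nu t)] = translate (alg_core A) k t) /\
   ([set a - t *: k | a in A & t in [set t : R | 0 < t]] `<=` alg_core A ->
    dom_phi A k = alg_core (dom_phi A k))) /\
  (* (e) *)
  (forall A0 : set Y, A `<=` A0 ->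
     dom_phi A k `<=` dom_phi A0 k /\
     (forall y : Y, dom_phi A k y -> le_nu (phi A0 k y) (phi A k y))) /\
  (* (f) *)
  (recession_cone A k ->
   forall y : Y, dom_phi A k y -> phi A k y = Some -oo%E).
Proof.
split; first exact: dom_phi_span.
split; first exact: phi_translate.
split; first by move=> t y /translateP /le_phi.
split; first by move=> t y /translateP /lt_phi_core.
split; first exact: sublevel_phi_recession.
split; first exact: phi_attained.
split; first exact: weak_sublevel_phi.
split.
  by split; [exact: strict_sublevel_phi_core|exact: dom_phi_alg_open].
by split; [move=> A0; exact: phi_antimono|exact: phi_recession].
Qed.
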